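(* Any frame over $\mathbb{C}^2$ that is strictly conjugate phase retrievable is contained in $\vartheta\mathbb{R}^2$. Furthermore: (1) any frame $\Phi\not\subseteq\vartheta\mathbb{R}^2$ on $\mathbb{C}^2$ that is conjugate phase retrievable must be complex phase retrievable and have at least four vectors; (2) any real-valued frame $\Phi\subset\mathbb{R}^2$ on $\mathbb{C}^2$ that is conjugate phase retrievable has at least three vectors.
   Context: A frame over $\mathbb{C}^M$ is a finite family of vectors $\Phi=\{\varphi_n\}_{n=1}^N\subset\mathbb{C}^M$ spanning $\mathbb{C}^M$. $\Phi$ is complex phase retrievable if for all $x,y\in\mathbb{C}^M$, $|\langle x,\varphi_n\rangle|=|\langle y,\varphi_n\rangle|$ for all $n$ implies $x=e^{i\theta}y$ for some $\theta\in\mathbb{R}$. $\Phi$ is conjugate phase retrievable if for all $x,y\in\mathbb{C}^M$, $|\langle x,\varphi_n\rangle|=|\langle y,\varphi_n\rangle|$ for all $n$ implies that there is $\theta\in\mathbb{R}$ with $x=e^{i\theta}y$ or $x=e^{i\theta}\overline{y}$, where $\overline{y}$ is the coordinatewise conjugate. $\Phi$ is strictly conjugate phase retrievable if it is conjugate phase retrievable but not complex phase retrievable. The set of phased real vectors is $\vartheta\mathbb{R}^M=\{\lambda v:\lambda\in\mathbb{C},\ |\lambda|=1,\ v\in\mathbb{R}^M\}$. *)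

(* Defs.v *)
(* MathComp-Analysis: the real numbers are any [R : realType], the complex
   numbers are [R[i]], and vectors of C^M are row vectors ['rV[R[i]]_M]. *)
From mathcomp Require Import all_boot all_order all_algebra.
From mathcomp Require Import spectral.
From mathcomp Require Export complex.
From mathcomp Require Import all_classical all_reals all_analysis.

Set Implicit Arguments.
Unset Strict Implicit.
Unset Printing Implicit Defensive.

Import Order.TTheory GRing.Theory Num.Theory.

Local Open Scope classical_set_scope.
Local Open Scope ring_scope.
Local Open Scope complex_scope.

(* exp (i t), by Euler's formula *)
Definition cexpi (R : realType) (t : R) : R[i] := cos t +i* sin t.

Definition conj_vec (R : realType) (M : nat) (y : 'rV[R[i]]_M) : 'rV[R[i]]_M :=
  map_mx Num.conj y.

Definition real_vec (R : realType) (M : nat) (v : 'rV[R]_M) : 'rV[R[i]]_M :=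
  map_mx (real_complex R) v.

Definition real_vectors (R : realType) (M : nat) : set 'rV[R[i]]_M :=
  range (@real_vec R M).

Definition phased_real_vectors (R : realType) (M : nat) : set 'rV[R[i]]_M :=
  [set x | exists (l : R[i]) (v : 'rV[R]_M),
     `|l| = 1 /\ x = l *: real_vec v].

(* A finite family is a tuple, so repeated vectors are allowed and counted. *)
Definition is_frame (R : realType) (M N : nat)
    (Phi : N.-tuple 'rV[R[i]]_M) : Prop :=
  <<Phi>>%VS = fullv.

(* [dotmx x y] is the sum of the [x_j * conj y_j]. *)
Definition same_magnitudes (R : realType) (M N : nat)
    (Phi : N.-tuple 'rV[R[i]]_M) (x y : 'rV[R[i]]_M) : Prop :=
  forall n : 'I_N, `|dotmx x (tnth Phi n)| = `|dotmx y (tnth Phi n)|.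

Definition complex_phase_retrievable (R : realType) (M N : nat)
    (Phi : N.-tuple 'rV[R[i]]_M) : Prop :=
  forall x y : 'rV[R[i]]_M, same_magnitudes Phi x y ->
    exists t : R, x = cexpi t *: y.

Definition conjugate_phase_retrievable (R : realType) (M N : nat)
    (Phi : N.-tuple 'rV[R[i]]_M) : Prop :=
  forall x y : 'rV[R[i]]_M, same_magnitudes Phi x y ->
    exists t : R, x = cexpi t *: y \/ x = cexpi t *: conj_vec y.

Definition strictly_conjugate_phase_retrievable (R : realType) (M N : nat)
    (Phi : N.-tuple 'rV[R[i]]_M) : Prop :=
  conjugate_phase_retrievable Phi /\ ~ complex_phase_retrievable Phi.

(* Main.v *)
Require Import Defs.
From mathcomp Require Import all_boot all_order all_algebra.
From mathcomp Require Import ring.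
From mathcomp Require Import spectral.
From mathcomp Require Import all_classical all_reals all_analysis.

Set Implicit Arguments.
Unset Strict Implicit.
Unset Printing Implicit Defensive.

Import Order.TTheory GRing.Theory Num.Theory.

Local Open Scope classical_set_scope.
Local Open Scope ring_scope.

(** For a vector [y] of [C^2] put [wedge y ybar = y_0 conj y_1 - y_1 conj y_0];
    up to a factor this is the imaginary part of [y_0 conj y_1]. The rank one
    matrices of [y] and of its conjugate differ by an antisymmetric matrix, and
    in dimension two antisymmetric matrices form a line, whence
      [|<y,phi>|^2 - |<ybar,phi>|^2 = - wedge y ybar * wedge phi phibar]
    ([sqr_dotmx_conj_vec]). A vector [y] has [wedge y ybar = 0] only when its
    conjugate is a unimodular multiple of it ([conj_vec_phase]), and such vectors
    are phased real ([phased_real_of_conj_phase]). Hence a vector of the frame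
    that is not phased real can tell [y] from [ybar] unless these agree up to a
    phase ([wedge_conj_eq0]), and the extra ambiguity that conjugate phase
    retrieval allows disappears: the frame is complex phase retrievable
    ([complex_of_conjugate_phase_retrievable]).

    For the cardinality bounds, retrieval forces two vectors of the frame to be
    linearly independent; let [a], [b] be the dual basis of such a pair. The
    signals [a + w b] and [a - w b], with [w <> 0], have the same magnitudes on
    the pair and are not proportional. A single further vector [chi] imposes
    the one real condition that [<a,chi>] and [w <b,chi>] be orthogonal as
    plane vectors, which can be met ([balanced_combination]); so three vectors
    never suffice for complex phase retrieval. For two real vectors, [w = 1]
    gives a pair of signals that conjugation does not relate either. *)

(** * Unimodular numbers and coordinates in dimension two *)

Lemma unit_norm_cexpi (R : realType) (z : R[i]) :
  `|z| = 1 -> exists t : R, z = cexpi t.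
Proof.
case: z => a b /(congr1 (fun z => z ^+ 2)); rewrite expr1n sqr_normc => -[h _].
have hab : a ^+ 2 + b ^+ 2 = 1 by rewrite -h; ring.
have ha : -1 <= a <= 1.
  rewrite -ler_norml -(@ler_pXn2r _ 2) ?nnegrE // expr1n real_normK ?num_real //.
  by rewrite -hab lerDl sqr_ge0.
have [_ cosa] := acos_def ha; have sina := sin_acos ha.
have {}sina : sin (acos a) = `|b| by rewrite sina -hab addrC addKr sqrtr_sqr.
case: (leP 0 b) => hb.
  by exists (acos a); rewrite /cexpi cosa sina ger0_norm.
by exists (- acos a); rewrite /cexpi cosN sinN cosa sina ltr0_norm // opprK.
Qed.

Lemma cexpiD (R : realType) (s t : R) : cexpi (s + t) = cexpi s * cexpi t.
Proof.
rewrite /cexpi cosD sinD; apply/eqP; rewrite eq_complex /=.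
by apply/andP; split; apply/eqP; ring.
Qed.

Lemma cexpi0 (R : realType) : cexpi (0 : R) = 1.
Proof. by rewrite /cexpi cos0 sin0. Qed.

Lemma conj_cexpi (R : realType) (t : R) : (cexpi t)^* = cexpi (- t).
Proof. by rewrite /cexpi cosN sinN. Qed.

Lemma norm_cexpi (R : realType) (t : R) : `|cexpi t| = 1.
Proof.
apply/eqP; rewrite -(@eqrXn2 _ 2) // normCK conj_cexpi -cexpiD subrr cexpi0.
by rewrite expr1n.
Qed.

Lemma eq_rV2 (T : Type) (x y : 'rV[T]_2) :
  x 0 0 = y 0 0 -> x 0 1 = y 0 1 -> x = y.
Proof.
move=> h0 h1; apply/rowP => k.
case: (unliftP 0 k) => [l|] -> //.
by rewrite ord1 (_ : lift _ _ = 1) //; exact: val_inj.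
Qed.

Lemma dotmx2 (C : numClosedFieldType) (x y : 'rV[C]_2) :
  dotmx x y = x 0 0 * (y 0 0)^* + x 0 1 * (y 0 1)^*.
Proof.
rewrite dotmxE mxE big_ord_recr big_ord1 !mxE.
by congr (x _ _ * (y _ _)^* + x _ _ * (y _ _)^*); apply: val_inj.
Qed.

Lemma dotmxDZ (C : numClosedFieldType) (M : nat) (a b chi : 'rV[C]_M) (w : C) :
  dotmx (a + w *: b) chi = dotmx a chi + w * dotmx b chi.
Proof. by rewrite !dotmxE mulmxDl -scalemxAl !mxE. Qed.

Lemma dotmxZ (C : numClosedFieldType) (M : nat) (c : C) (x chi : 'rV[C]_M) :
  dotmx (c *: x) chi = c * dotmx x chi.
Proof. by rewrite !dotmxE -scalemxAl mxE. Qed.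

Lemma eq_norm_sqr (C : numClosedFieldType) (x y : C) :
  x * x^* = y * y^* -> `|x| = `|y|.
Proof. by rewrite -!normCK => /eqP; rewrite eqrXn2 // => /eqP. Qed.

(** * Vectors with the same magnitudes as their conjugate *)

Definition wedge (C : comNzRingType) (x y : 'rV[C]_2) : C :=
  x 0 0 * y 0 1 - x 0 1 * y 0 0.

Lemma sqr_dotmx_conj_vec (C : numClosedFieldType) (y phi : 'rV[C]_2) :
  `|dotmx y phi| ^+ 2 - `|dotmx (map_mx Num.conj y) phi| ^+ 2
  = - (wedge y (map_mx Num.conj y) * wedge phi (map_mx Num.conj phi)).
Proof.
by rewrite !normCK !dotmx2 /wedge !mxE !(rmorphD, rmorphM) /= !conjCK; ring.
Qed.

Lemma wedge_conj_eq0 (C : numClosedFieldType) (y phi : 'rV[C]_2) :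
  wedge phi (map_mx Num.conj phi) != 0 ->
  `|dotmx y phi| = `|dotmx (map_mx Num.conj y) phi| ->
  wedge y (map_mx Num.conj y) = 0.
Proof.
move=> phi0 mag; have /esym/eqP := sqr_dotmx_conj_vec y phi.
by rewrite mag subrr oppr_eq0 mulf_eq0 (negbTE phi0) orbF => /eqP.
Qed.

Lemma conj_vec_phase (R : realType) (y : 'rV[R[i]]_2) :
  wedge y (conj_vec y) = 0 -> exists t : R, conj_vec y = cexpi t *: y.
Proof.
rewrite /wedge !mxE => /eqP; rewrite subr_eq0 => /eqP h.
have phase (z : R[i]) : z != 0 -> exists t : R, cexpi t = z^* / z.
  move=> z0; have [|t ->] := @unit_norm_cexpi R (z^* / z); last by exists t.
  by rewrite normf_div norm_conjC divff // normr_eq0.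
have [y0|y0] := eqVneq (y 0 0) 0; last first.
  have [t et] := phase _ y0; exists t; rewrite et.
  by apply: eq_rV2; rewrite !mxE ?mulfVK // mulrAC [X in X / _]mulrC -h mulrC mulKf.
have [y1|y1] := eqVneq (y 0 1) 0.
  by exists 0; apply: eq_rV2; rewrite !mxE ?y0 ?y1 conjC0 mulr0.
have [t et] := phase _ y1; exists t; rewrite et.
by apply: eq_rV2; rewrite !mxE ?mulfVK // y0 conjC0 mulr0.
Qed.

(** Rotating [y] by half of the phase that takes it to its conjugate makes it
    fixed by conjugation. *)
Lemma phased_real_of_conj_phase (R : realType) (M : nat) (y : 'rV[R[i]]_M)
    (t : R) :
  conj_vec y = cexpi t *: y -> phased_real_vectors y.
Proof.
move=> /rowP h; set s := t / 2.
have es : t = s + s by rewrite /s; field.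
exists (cexpi (- s)), (map_mx (@complex.Re R) (cexpi s *: y)); split.
  exact: norm_cexpi.
apply/rowP => k; have := h k; rewrite !mxE => hk.
have : (cexpi s * y 0 k)^* = cexpi s * y 0 k.
  by rewrite rmorphM /= conj_cexpi hk es mulrA -cexpiD addKr.
set z := cexpi s * y 0 k => hz.
have -> : real_complex R (complex.Re z) = z.
  rewrite [LHS]ReJ_add (_ : (z^*)%C = z) // (_ : z + z = z * 2); last by ring.
  by rewrite mulfK // pnatr_eq0.
by rewrite /z mulrA -cexpiD addNr cexpi0 mul1r.
Qed.

Lemma complex_of_conjugate_phase_retrievable (R : realType) (N : nat)
    (Phi : N.-tuple 'rV[R[i]]_2) :
  ~ ([set` Phi] `<=` @phased_real_vectors R 2) ->
  conjugate_phase_retrievable Phi -> complex_phase_retrievable Phi.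
Proof.
move=> /existsNP[_ /not_implyP[/= /tnthP[n ->] nreal]] cpr x y mag.
have [t [|ex]] := cpr _ _ mag; first by exists t.
have phi_wedge : wedge (tnth Phi n) (conj_vec (tnth Phi n)) != 0.
  by apply/eqP => /conj_vec_phase[s /phased_real_of_conj_phase].
have mag_conj := mag n.
rewrite ex dotmxZ normrM norm_cexpi mul1r in mag_conj.
have /conj_vec_phase[s es] := wedge_conj_eq0 phi_wedge (esym mag_conj).
by exists (t + s); rewrite ex es scalerA cexpiD.
Qed.

(** * Few measurements leave an ambiguity *)

(** If every two vectors of the frame were proportional, some nonzero signal
    would be orthogonal to all of them, hence indistinguishable from zero. *)
Lemma exists_wedge_neq0 (R : realType) (N : nat) (Phi : N.-tuple 'rV[R[i]]_2) :
  conjugate_phase_retrievable Phi ->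
  exists i j : 'I_N, wedge (tnth Phi i) (tnth Phi j) != 0.
Proof.
move=> cpr; apply: contrapT => noij.
have wedge0 i j : wedge (tnth Phi i) (tnth Phi j) = 0.
  by apply: contrapT => /eqP h; apply: noij; exists i, j.
have orth0 (x : 'rV[R[i]]_2) : (forall n, dotmx x (tnth Phi n) = 0) -> x = 0.
  move=> hx; have [|t] := cpr x 0.
    by move=> n; rewrite hx dotmx2 !mxE !mul0r addr0.
  have -> : conj_vec 0 = 0 :> 'rV[R[i]]_2.
    by apply/rowP => k; rewrite !mxE conjC0.
  by rewrite scaler0 => -[].
(* The signal orthogonal to [Phi i] is orthogonal to the whole frame, so it is
   zero; its entries are those of [Phi i] up to order, sign and conjugation. *)
have Phi0 i : tnth Phi i = 0.
  pose x : 'rV[R[i]]_2 :=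
    \row_k if k == 0 then (tnth Phi i 0 1)^* else - (tnth Phi i 0 0)^*.
  have x0 k : x 0 k = 0.
    rewrite (orth0 x) ?mxE // => n.
    have := congr1 Num.conj (wedge0 n i).
    by rewrite dotmx2 !mxE /wedge rmorphB !rmorphM rmorph0 /= => <-; ring.
  apply: eq_rV2; rewrite mxE; apply/eqP; rewrite -conjC_eq0.
    by rewrite -oppr_eq0; have := x0 1; rewrite mxE /= => ->.
  by have := x0 0; rewrite mxE /= => ->.
have : (const_mx 1 : 'rV[R[i]]_2) 0 0 = 0.
  rewrite (orth0 (const_mx 1)) ?mxE // => n.
  by rewrite Phi0 dotmx2 !mxE conjC0 !mulr0 addr0.
by move=> /eqP; rewrite mxE oner_eq0.
Qed.

(** Cramer's rule; the dual basis of the pair and, in the real case, the two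
    ambiguous signals are instances. *)
Lemma exists_dotmx_eq (C : numClosedFieldType) (phi psi : 'rV[C]_2) (u v : C) :
  wedge phi psi != 0 ->
  exists x : 'rV[C]_2, dotmx x phi = u /\ dotmx x psi = v.
Proof.
rewrite -conjC_eq0 /wedge rmorphB !rmorphM /= => D0.
exists (\row_k ((if k == 0 then u * (psi 0 1)^* - v * (phi 0 1)^*
                else v * (phi 0 0)^* - u * (psi 0 0)^*)
        / ((phi 0 0)^* * (psi 0 1)^* - (phi 0 1)^* * (psi 0 0)^*))).
by rewrite !dotmx2 !mxE /=; split; field.
Qed.

(** With [p = <a,chi>] and [q = <b,chi>] the two squared magnitudes differ by
    four times the real part of [p conj (w q)], and [w = i p conj q] makes that
    number imaginary. When [p conj q = 0] every [w] works. *)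
Lemma balanced_combination (C : numClosedFieldType) (M : nat)
    (a b chi : 'rV[C]_M) :
  exists2 w : C, w != 0 &
    `|dotmx (a + w *: b) chi| = `|dotmx (a + - w *: b) chi|.
Proof.
set p := dotmx a chi; set q := dotmx b chi.
have [pq0|pq0] := eqVneq (p * q^*) 0; last first.
  exists ('i * (p * q^*)); first by rewrite mulf_neq0 // neq0Ci.
  apply: eq_norm_sqr; rewrite !dotmxDZ -/p -/q.
  by rewrite !(rmorphD, rmorphN, rmorphM) /= conjCi conjCK; ring.
exists 1; first exact: oner_neq0.
apply: eq_norm_sqr; rewrite !dotmxDZ -/p -/q mul1r mulN1r rmorphD rmorphB.
apply/eqP; rewrite -subr_eq0.
have -> : (p + q) * (p^* + q^*) - (p - q) * (p^* - q^*)
          = (p * q^* + p^* * q) *+ 2 by ring.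
by rewrite -[q in p^* * q]conjCK -rmorphM pq0 rmorph0 addr0 mul0rn.
Qed.

(** A common measurement [1] forces the factor of proportionality to be [1]. *)
Lemma dual_combination_nonproportional (C : numClosedFieldType) (M : nat)
    (phi psi x y : 'rV[C]_M) (w c : C) :
  w != 0 -> dotmx x phi = 1 -> dotmx x psi = w ->
  dotmx y phi = 1 -> dotmx y psi = - w -> x <> c *: y.
Proof.
move=> w0 x1 xw y1 yw ex.
have c1 : c = 1 by move: x1; rewrite ex dotmxZ y1 mulr1.
move: xw => /eqP; rewrite ex dotmxZ yw c1 mul1r eq_sym -addr_eq0 -mulr2n.
by rewrite mulrn_eq0 (negbTE w0).
Qed.

Lemma wedge_neq0_neq (C : comNzRingType) (I : eqType) (f : I -> 'rV[C]_2) (i j : I) :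
  wedge (f i) (f j) != 0 -> i != j.
Proof. by apply: contraNneq => ->; rewrite /wedge mulrC subrr. Qed.

Lemma ord_mem_uniq (N : nat) (s : seq 'I_N) (n : 'I_N) :
  uniq s -> (N <= size s)%N -> n \in s.
Proof.
move=> us Ns; apply: contraTT Ns => ns; rewrite -ltnNge.
have /card_uniqP/= <- : uniq (n :: s) by rewrite /= ns.
by rewrite -[leqRHS]card_ord max_card.
Qed.

Lemma complex_phase_retrievable_card (R : realType) (N : nat)
    (Phi : N.-tuple 'rV[R[i]]_2) :
  complex_phase_retrievable Phi -> (4 <= N)%N.
Proof.
move=> pr; rewrite leqNgt; apply/negP; rewrite ltnS => N3.
have [|i [j wij]] := @exists_wedge_neq0 R N Phi.
  by move=> x y /pr[t ->]; exists t; left.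
have ij := wedge_neq0_neq wij.
(* Any third index serves as [k]; if there is none, [k] repeats [i]. *)
have [k cover] : exists k : 'I_N, forall n, n \in [:: i; j; k].
  have [[k kij]|none] := pselect (exists k, k \notin [:: i; j]); last first.
    exists i => n; have : n \in [:: i; j].
      by apply: contrapT => /negP h; apply: none; exists n.
    by rewrite !inE => /orP[]->; rewrite ?orbT.
  exists k => n; apply: ord_mem_uniq => //=.
  by move: kij; rewrite !inE !negb_or ij andbT ![k == _]eq_sym.
have [a [ai aj]] := exists_dotmx_eq 1 0 wij.
have [b [bi bj]] := exists_dotmx_eq 0 1 wij.
have [w w0 wk] := balanced_combination a b (tnth Phi k).
have dot_i z : dotmx (a + z *: b) (tnth Phi i) = 1.
  by rewrite dotmxDZ ai bi mulr0 addr0.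
have dot_j z : dotmx (a + z *: b) (tnth Phi j) = z.
  by rewrite dotmxDZ aj bj mulr1 add0r.
have [|t] := pr (a + w *: b) (a + - w *: b); last first.
  exact: dual_combination_nonproportional w0 (dot_i w) (dot_j w) (dot_i _) (dot_j _).
move=> n; have := cover n; rewrite !inE => /or3P[] /eqP->.
- by rewrite (dot_i w) (dot_i (- w)).
- by rewrite (dot_j w) (dot_j (- w)) normrN.
- exact: wk.
Qed.

Lemma dotmx_conj_vec_real (R : realType) (y : 'rV[R[i]]_2) (v : 'rV[R]_2) :
  dotmx (conj_vec y) (real_vec v) = (dotmx y (real_vec v))^*.
Proof.
have rr (r : R) : (real_complex R r)^* = real_complex R r by exact: conjc_real.
by rewrite !dotmx2 !mxE !(rmorphD, rmorphM) /= !rr.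
Qed.

Lemma real_conjugate_phase_retrievable_card (R : realType) (N : nat)
    (Phi : N.-tuple 'rV[R[i]]_2) :
  [set` Phi] `<=` @real_vectors R 2 -> conjugate_phase_retrievable Phi ->
  (3 <= N)%N.
Proof.
move=> Phi_real cpr; rewrite leqNgt; apply/negP; rewrite ltnS => N2.
have [i [j wij]] := exists_wedge_neq0 cpr.
have cover n : n \in [:: i; j].
  by apply: ord_mem_uniq; rewrite //= inE (wedge_neq0_neq wij).
have [x [xi xj]] := exists_dotmx_eq 1 1 wij.
have [y [yi yj]] := exists_dotmx_eq 1 (-1) wij.
(* As the frame is real and [y] has real measurements, conjugating [y] leaves
   them unchanged. *)
have conj_dot n : dotmx (conj_vec y) (tnth Phi n) = (dotmx y (tnth Phi n))^*.
  have [v _ <-] := Phi_real _ (mem_tnth n Phi); exact: dotmx_conj_vec_real.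
have nonprop c (z : 'rV[R[i]]_2) :=
  @dual_combination_nonproportional _ _ _ _ x z 1 c (oner_neq0 _) xi xj.
have [|t [|]] := cpr x y.
- by move=> n; have := cover n; rewrite !inE => /orP[] /eqP->;
    rewrite ?xi ?xj ?yi ?yj ?normrN.
- exact: nonprop.
- by apply: nonprop; rewrite conj_dot ?yi ?yj ?rmorphN rmorph1.
Qed.

Theorem theorem6p5 (R : realType) :
  (forall (N : nat) (Phi : N.-tuple 'rV[R[i]]_2),
     is_frame Phi -> strictly_conjugate_phase_retrievable Phi ->
     [set` Phi] `<=` @phased_real_vectors R 2)
  /\ (forall (N : nat) (Phi : N.-tuple 'rV[R[i]]_2),
     is_frame Phi -> ~ ([set` Phi] `<=` @phased_real_vectors R 2) ->
     conjugate_phase_retrievable Phi ->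
     complex_phase_retrievable Phi /\ (4 <= N)%N)
  /\ (forall (N : nat) (Phi : N.-tuple 'rV[R[i]]_2),
     is_frame Phi -> [set` Phi] `<=` @real_vectors R 2 ->
     conjugate_phase_retrievable Phi ->
     (3 <= N)%N).
Proof.
split; [|split].
- move=> N Phi _ [cpr npr]; apply: contrapT => nreal.
  exact/npr/complex_of_conjugate_phase_retrievable.
- move=> N Phi _ nreal cpr.
  have pr := complex_of_conjugate_phase_retrievable nreal cpr.
  by split => //; exact: complex_phase_retrievable_card pr.
- by move=> N Phi _; exact: real_conjugate_phase_retrievable_card.
Qed.
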